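(* Let $X = Y = [0,1]$ and let $\mu=\nu=\lambda$ be Lebesgue measure on $[0,1]$. Then there exists a bounded continuous function $h\colon X\times Y\times\mathcal P(Y)\to\mathbb R$ (where $\mathcal P(Y)$ carries the weak topology), which is moreover Lipschitz when $\mathcal P(Y)$ is equipped with the metric induced by the Kantorovich--Rubinshtein norm, such that for all $x\in X$, $y\in Y$ the function $p\mapsto h(x,y,p)$ is convex on $\mathcal P(Y)$, and such that the nonlinear Kantorovich problem $$ \int_{X\times Y} h(x,y,\sigma^x)\,\sigma(dx\,dy)\to\inf,\qquad \sigma\in\Pi(\mu,\nu),\quad \sigma(dx\,dy)=\sigma^x(dy)\,\mu(dx), $$ has no minimizer, i.e. the infimum over $\sigma\in\Pi(\mu,\nu)$ is not attained.
   Context: $\mathcal P(Y)$ denotes the set of Borel probability measures on $Y$ with the weak topology (generated by integrals of bounded continuous functions). $\Pi(\mu,\nu)$ is the set of Borel probability measures on $X\times Y$ with projections $\mu$ on $X$ and $\nu$ on $Y$. For $\sigma\in\Pi(\mu,\nu)$, the measures $\sigma^x\in\mathcal P(Y)$, $x\in X$, are the conditional measures (disintegration) of $\sigma$ with respect to $\mu$: $x\mapsto\sigma^x(B)$ is $\mu$-measurable for each Borel $B\subset Y$, and $\int_{X\times Y}\varphi(x)\psi(y)\,\sigma(dx\,dy)=\int_X\int_Y\varphi(x)\psi(y)\,\sigma^x(dy)\,\mu(dx)$ for all bounded Borel $\varphi,\psi$; this is written $\sigma(dx\,dy)=\sigma^x(dy)\,\mu(dx)$. The Kantorovich--Rubinshtein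 norm of a signed measure $\eta$ on a metric space $Z$ is $\|\eta\|_{KR}=\sup\{\int_Z f\,d\eta : f \text{ is } 1\text{-Lipschitz},\ |f|\le 1\}$. *)

(* Defs.v *)
From HB Require Import structures.
From mathcomp Require Import all_boot all_order all_algebra.
From mathcomp Require Import all_classical all_reals all_analysis.
From mathcomp Require Import measurable_realfun.

Set Implicit Arguments.
Unset Strict Implicit.
Unset Printing Implicit Defensive.

Import Order.TTheory GRing.Theory Num.Theory.
Import numFieldNormedType.Exports.

Local Open Scope classical_set_scope.
Local Open Scope ring_scope.

Section convex_combination.
Context d (T : measurableType d) (R : realType).
Variables (t : {i01 R}) (p q : probability T R).

Definition conv_measure (A : set T) : \bar R :=
  ((t%:num)%:E * p A + (1 - t%:num)%:E * q A)%E.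

Let t0 : 0 <= t%:num :> R. Proof. exact: ge0. Qed.

Let t1 : 0 <= 1 - t%:num :> R. Proof. by rewrite subr_ge0 le1. Qed.

Let conv_measure0 : conv_measure set0 = 0%E.
Proof. by rewrite /conv_measure !measure0 !mule0 adde0. Qed.

Let conv_measure_ge0 A : (0 <= conv_measure A)%E.
Proof. by rewrite adde_ge0// mule_ge0// lee_fin. Qed.

Let conv_measure_sigma_additive : semi_sigma_additive conv_measure.
Proof.
pose m := measure_add (mscale (NngNum t0) p) (mscale (NngNum t1) q).
have -> : conv_measure = m.
  by apply/funext => A; rewrite /m measure_addE.
exact: measure_semi_sigma_additive.
Qed.

HB.instance Definition _ := isMeasure.Build _ _ _ conv_measure
  conv_measure0 conv_measure_ge0 conv_measure_sigma_additive.

Let conv_measureT : conv_measure [set: T] = 1%E.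
Proof.
by rewrite /conv_measure !probability_setT !mule1 -EFinD addrC subrK.
Qed.

HB.instance Definition _ :=
  Measure_isProbability.Build _ _ _ conv_measure conv_measureT.

End convex_combination.

Section transport_plans.
Context d1 d2 (X : measurableType d1) (Y : measurableType d2) (R : realType).

Definition transport_plan (mu : probability X R) (nu : probability Y R)
    (sigma : probability (X * Y)%type R) : Prop :=
  (forall A, measurable A -> sigma (fst @^-1` A) = mu A) /\
  (forall B, measurable B -> sigma (snd @^-1` B) = nu B).

(* Measurability with respect to the mu-completion of the sigma-algebra of X:
   every preimage is the union of a measurable set and a mu-negligible one. *)
Definition mu_measurable (mu : probability X R) (f : X -> \bar R) : Prop :=
  forall B : set (\bar R), measurable B -> completed_algebra_gen mu (f @^-1` B).

(* The integrand of the outer integral over X below is only measurable with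
   respect to the mu-completion. It coincides mu-a.e. with a bounded measurable
   function, and the library integral of such an integrand, being defined from
   below by simple functions, is its integral for the completed measure. *)
Definition conditional_measures (mu : probability X R)
    (sigma : probability (X * Y)%type R) (s : X -> probability Y R) : Prop :=
  (forall B, measurable B -> mu_measurable mu (fun x => s x B)) /\
  (forall (phi : X -> R) (psi : Y -> R),
    measurable_fun setT phi -> bounded_fun phi ->
    measurable_fun setT psi -> bounded_fun psi ->
    \int[sigma]_z (phi z.1 * psi z.2) =
    \int[mu]_x \int[s x]_y (phi x * psi y)).

(* For bounded continuous h the cost of sigma does not depend on the choice of
   its conditional measures s, which are unique up to a mu-negligible set. *)
Definition kantorovich_cost (h : X * Y * probability Y R -> R)
    (sigma : probability (X * Y)%type R) (s : X -> probability Y R) : R :=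
  \int[sigma]_z h (z, s z.1).

Definition kantorovich_minimizer (h : X * Y * probability Y R -> R)
    (mu : probability X R) (nu : probability Y R)
    (sigma : probability (X * Y)%type R) : Prop :=
  transport_plan mu nu sigma /\
  exists2 s, conditional_measures mu sigma s &
  forall sigma' s', transport_plan mu nu sigma' ->
    conditional_measures mu sigma' s' ->
    kantorovich_cost h sigma s <= kantorovich_cost h sigma' s'.

End transport_plans.

Definition I01 (R : realType) : Type := set_type `[0%R : R, 1%R].

Section unit_interval.
Variable R : realType.

HB.instance Definition _ := PseudoMetric.on (I01 R).

Definition i01_val (x : I01 R) : R := set_val x.

Lemma i01_zero_subproof : (0 : R) \in `[0%R : R, 1%R]%classic.
Proof. by rewrite inE/= in_itv/= lexx ler01. Qed.

HB.instance Definition _ :=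
  isPointed.Build (I01 R) (exist _ (0 : R) i01_zero_subproof).

HB.instance Definition _ :=
  Measurable.copy (I01 R) (g_sigma_algebraType (@open (I01 R))).

Lemma i01_val_inj : injective i01_val.
Proof. by move=> x y /val_inj. Qed.

Lemma i01_val_image_preimage (U : set R) :
  i01_val @` (i01_val @^-1` U) = U `&` `[0%R, 1%R].
Proof.
apply/seteqP; split=> [_ [x Ux <-]|r [Ur r01]].
  by split=> //; exact: set_valP.
by exists (exist _ r (mem_set r01)).
Qed.

Lemma measurable_i01_image (A : set (I01 R)) : measurable A ->
  measurable (i01_val @` A : set (measurableTypeR R)).
Proof.
pose G := [set A : set (I01 R) |
  measurable (i01_val @` A : set (measurableTypeR R))].
suff : <<s @open (I01 R) >> `<=` G by apply.
apply: smallest_sub; first split.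
- by rewrite /G/= image_set0.
- move=> B GB; rewrite /G/= setTD.
  have -> : i01_val @` (~` B) = `[0%R, 1%R]%classic `\` (i01_val @` B).
    apply/seteqP; split=> [_ [x Bx <-]|r [r01 nBr]].
      split; first exact: set_valP.
      by move=> [y By] /i01_val_inj yx; apply: Bx; rewrite -yx.
    by exists (exist _ r (mem_set r01)) => // Br; apply: nBr; eexists; eauto.
  exact: measurableD.
- move=> F GF; rewrite /G/= image_bigcup.
  exact: bigcupT_measurable.
- move=> _ [U oU <-]; rewrite /G/= i01_val_image_preimage.
  by apply: measurableI => //; exact: open_measurable.
Qed.

(* Lebesgue measure on [0,1], as the restriction of the one on the line. *)
Definition lebesgue01 (A : set (I01 R)) : \bar R :=
  lebesgue_measure (i01_val @` A : set (measurableTypeR R)).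

Let lebesgue01_0 : lebesgue01 set0 = 0%E.
Proof. by rewrite /lebesgue01 image_set0 measure0. Qed.

Let lebesgue01_ge0 A : (0 <= lebesgue01 A)%E.
Proof. exact: measure_ge0. Qed.

Let lebesgue01_sigma_additive : semi_sigma_additive lebesgue01.
Proof.
move=> F mF tF mUF; rewrite /lebesgue01 image_bigcup.
apply: (@measure_semi_sigma_additive _ _ _ (@lebesgue_measure R)).
- by move=> i; exact: measurable_i01_image.
- apply/trivIsetP => i j _ _ ij; rewrite -subset0 => _ [[x Fx <-] [y Fy]].
  move=> /i01_val_inj yx; rewrite yx in Fy.
  by move/trivIsetP : tF => /(_ i j I I ij); rewrite -subset0 => /(_ x); exact.
- by apply: bigcupT_measurable => i; exact: measurable_i01_image.
Qed.

HB.instance Definition _ := isMeasure.Build _ _ _ lebesgue01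
  lebesgue01_0 lebesgue01_ge0 lebesgue01_sigma_additive.

Let lebesgue01_setT : lebesgue01 [set: I01 R] = 1%E.
Proof.
rewrite /lebesgue01 -(preimage_setT i01_val) i01_val_image_preimage setTI.
by rewrite lebesgue_measure_itv/= lte_fin ltr01 -EFinB subr0.
Qed.

HB.instance Definition _ :=
  Measure_isProbability.Build _ _ _ lebesgue01 lebesgue01_setT.

(* P([0,1]), carrying the weak topology: the coarsest one that makes all
   integrals of bounded continuous functions continuous. *)
Definition prob01 : Type := probability (I01 R) R.

HB.instance Definition _ := Choice.copy prob01 (probability (I01 R) R).

Definition weak_topology_prob01 : Type :=
  @sup_topology prob01
    {f : I01 R -> R | continuous f /\ bounded_fun f}
    (fun f => Topological.class
      (initial_topology (fun p : prob01 =>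
         \int[p : probability (I01 R) R]_y (projT1 f y)))).

HB.instance Definition _ := Topological.copy prob01 weak_topology_prob01.

Definition prob01_conv (t : {i01 R}) (p q : prob01) : prob01 :=
  conv_measure t p q : probability (I01 R) R.

(* The Kantorovich-Rubinshtein norm of p - q. *)
Definition KR_dist (p q : probability (I01 R) R) : R :=
  sup [set \int[p]_y f y - \int[q]_y f y | f in [set f : I01 R -> R |
    (forall y z, `|f y - f z| <= `|i01_val y - i01_val z|) /\
    (forall y, `|f y| <= 1)]].

End unit_interval.

Arguments lebesgue01 {R}.

(* Main.v *)
(** The cost is h(x, y, p) = dist(2y - x, {0, 1}) + \int |y - w| p(dw), which is
    affine in p. Its first term forces y to lie on one of the two lines
    y = x/2, y = (x+1)/2; the integral of the second one against p vanishes only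
    if p is a Dirac mass. An interval exchange sending the even blocks of length
    1/2N of [0,1] to the left half and the odd ones to the right half preserves
    Lebesgue measure and stays within O(1/N) of the two lines, so the infimum is
    0. A plan of cost 0 would be carried by the two lines; comparing its second
    marginal on (0,1/2) and (1/2,1) shows that sigma^x gives mass 1/2 to each
    half for almost every x, so that it is not a Dirac mass and the second term
    has a positive integral. *)
Require Import Defs.
From mathcomp Require Import all_boot all_order all_algebra.
From mathcomp Require Import all_classical all_reals all_analysis.
From mathcomp Require Import measurable_realfun zify ring lra.
Import Order.TTheory GRing.Theory Num.Theory.
Import numFieldNormedType.Exports.
Local Open Scope classical_set_scope.
Local Open Scope ring_scope.

Set Implicit Arguments.
Unset Strict Implicit.
Unset Printing Implicit Defensive.

(** * Integrals of bounded functions against a probability *)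

Section probability_integrals.
Context d (T : measurableType d) (R : realType) (P : probability T R).
Import HBNNSimple.

(* The integral of a nonnegative function is a supremum over simple functions,
   hence monotone without any measurability assumption. *)
Lemma le_Rintegral_nonmeasurable (f g : T -> R) (M : R) :
  (forall x, 0 <= f x) -> (forall x, f x <= g x) -> (forall x, g x <= M) ->
  \int[P]_x f x <= \int[P]_x g x.
Proof.
move=> f0 fg gM.
have le_int (u v : T -> R) : (forall x, 0 <= u x) -> (forall x, u x <= v x) ->
    (\int[P]_x (u x)%:E <= \int[P]_x (v x)%:E)%E.
  move=> u0 uv; rewrite !ge0_integralTE; first last.
  - by move=> x; rewrite lee_fin.
  - by move=> x; rewrite lee_fin (le_trans (u0 x)).
  apply: ereal_sup_le => _ [k ku <-]; exists k => // x.
  by rewrite (le_trans (ku x))// lee_fin.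
have int_fin (w : T -> R) : (forall x, 0 <= w x) -> (forall x, w x <= M) ->
    (\int[P]_x (w x)%:E)%E \is a fin_num.
  move=> w0 wM; rewrite ge0_fin_numE; last first.
    by apply: integral_ge0 => x _; rewrite lee_fin.
  apply: (le_lt_trans (le_int _ (cst M) w0 wM)).
  by rewrite -/(cst M%:E) integral_cst//= probability_setT mule1 ltry.
have g0 x : 0 <= g x by exact: le_trans (fg x).
apply: fine_le; [apply: int_fin => // x|exact: int_fin|exact: le_int].
exact: le_trans (fg x) _.
Qed.

Lemma Rintegral_cst_probability (c : R) : \int[P]_x c = c.
Proof. by rewrite Rintegral_cst//= probability_setT mulr1. Qed.

Lemma integrable_probability (f : T -> R) (M : R) :
  measurable_fun setT f -> (forall x, `|f x| <= M) ->
  P.-integrable setT (EFin \o f).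
Proof.
move=> mf fM; apply: measurable_bounded_integrable => //.
  by rewrite -ge0_fin_numE// fin_num_measure.
exists M; split; first exact: num_real.
by move=> r Mr x _ /=; rewrite (le_trans (fM x))// ltW.
Qed.

Lemma Rintegral_indic (A : set T) (c : R) : measurable A ->
  \int[P]_x (c * \1_A x) = c * fine (P A).
Proof.
move=> mA; rewrite RintegralZl//; last first.
  apply: (@integrable_probability _ 1) => // x.
  by rewrite indicE ger0_norm ?lern1 ?leq_b1.
by congr (_ * fine _); rewrite integral_indic// setIT.
Qed.

Lemma normr_Rintegral_le (f : T -> R) (M : R) :
  measurable_fun setT f -> (forall x, `|f x| <= M) -> `|\int[P]_x f x| <= M.
Proof.
move=> mf fM; have If := integrable_probability mf fM.
apply: (le_trans (le_normr_Rintegral measurableT If)).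
rewrite -[leRHS]Rintegral_cst_probability.
by apply: (@le_Rintegral_nonmeasurable _ _ M).
Qed.

End probability_integrals.

(** * The cost and its elementary bounds *)

Section cost_function.
Variable R : realType.
Implicit Types (x y w : I01 R) (p q : prob01 R).

Lemma i01_val_ge0 x : 0 <= i01_val x.
Proof. by have := set_valP x; rewrite /= in_itv/= => /andP[]. Qed.

Lemma i01_val_le1 x : i01_val x <= 1.
Proof. by have := set_valP x; rewrite /= in_itv/= => /andP[]. Qed.

Lemma continuous_i01_val : continuous (@i01_val R).
Proof. exact: initial_continuous. Qed.

Lemma continuous_i01_measurable (f : I01 R -> R) :
  continuous f -> measurable_fun setT f.
Proof.
move=> /continuousP cf; apply: (measurability (@RGenOpens.G R)).
  exact: RGenOpens.measurableE.
move=> _ [_ [a [b ->] <-]]; rewrite setTI.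
by apply: sub_sigma_algebra; exact/cf/interval_open.
Qed.

Lemma measurable_i01_val : measurable_fun setT (@i01_val R).
Proof. exact: continuous_i01_measurable continuous_i01_val. Qed.

Definition i01_dist x y : R := `|i01_val x - i01_val y|.

Lemma i01_dist_le1 x y : i01_dist x y <= 1.
Proof.
by rewrite ler_norml; have := (i01_val_ge0 x, i01_val_le1 x, i01_val_ge0 y,
  i01_val_le1 y) => -[[[? ?] ?] ?]; apply/andP; split; lra.
Qed.

Lemma continuous_i01_dist x : continuous (i01_dist x).
Proof.
move=> y; apply: (@cvg_norm _ _ _ (nbhs y) (nbhs_filter y)).
apply: (@cvgB _ _ _ (nbhs y) (nbhs_filter y) (fun=> i01_val x) (@i01_val R)).
  exact: cvg_cst.
exact: continuous_i01_val.
Qed.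

Lemma measurable_i01_dist x : measurable_fun setT (i01_dist x).
Proof. exact: continuous_i01_measurable (@continuous_i01_dist x). Qed.

(* Distance of 2y - x to {0, 1}. *)
Definition graph_gap x y : R :=
  `| `|2 * i01_val y - i01_val x - 1/2| - 1/2|.

(** This is the Wasserstein-1 distance from p to the Dirac mass at y. *)
Definition mean_dist y p : R :=
  \int[p : probability (I01 R) R]_w i01_dist y w.

Definition cost z : R := graph_gap z.1.1 z.1.2 + mean_dist z.1.2 z.2.

Lemma mean_dist_ge0 y p : 0 <= mean_dist y p.
Proof. by apply: Rintegral_ge0 => w _; exact: normr_ge0. Qed.

Lemma mean_dist_le1 y p : mean_dist y p <= 1.
Proof.
rewrite -[leRHS](Rintegral_cst_probability (p : probability (I01 R) R)).
apply: (@le_Rintegral_nonmeasurable _ _ _ _ _ _ 1) => // w.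
  exact: normr_ge0.
exact: i01_dist_le1.
Qed.

Lemma graph_gap_ge0 x y : 0 <= graph_gap x y.
Proof. exact: normr_ge0. Qed.

Lemma graph_gap_le1 x y : graph_gap x y <= 1.
Proof.
have := (i01_val_ge0 x, i01_val_le1 x, i01_val_ge0 y, i01_val_le1 y).
move=> -[[[? ?] ?] ?]; rewrite /graph_gap ler_norml.
set u := 2 * _ - _ - 1 / 2; have : `|u| <= 3 / 2.
  by rewrite ler_norml /u; apply/andP; split; lra.
by have := normr_ge0 u => ? ?; apply/andP; split; lra.
Qed.

(** Two reverse triangle inequalities peel off the nested absolute values. The one-sided form
    suffices, since it is applied again with the two points exchanged. *)
Lemma graph_gap_lip x x' y y' :
  graph_gap x y - graph_gap x' y' <= i01_dist x x' + 2 * i01_dist y y'.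
Proof.
rewrite /graph_gap /i01_dist.
move: (i01_val x) (i01_val x') (i01_val y) (i01_val y') => a a' b b'.
apply: (le_trans (lerB_dist _ _)).
apply: (@le_trans _ _ `|(2 * b - a - 1 / 2) - (2 * b' - a' - 1 / 2)|).
  set u := (X in `|X| - _ - _); set v := (X in _ - (`|X| - _)).
  by rewrite (_ : _ - _ = `|u| - `|v|); [exact: ler_dist_dist|lra].
rewrite (_ : _ - _ = (a' - a) + 2 * (b - b')); last by lra.
apply: (le_trans (ler_normD _ _)).
by rewrite normrM (distrC a') (ger0_norm (ler0n _ 2)).
Qed.

Lemma i01_dist_lip y y' w :
  `|i01_dist y w - i01_dist y' w| <= i01_dist y y'.
Proof.
apply: (le_trans (ler_dist_dist _ _)); rewrite /i01_dist.
by rewrite (_ : _ - _ - _ = i01_val y - i01_val y')//; lra.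
Qed.

End cost_function.

(** * Lipschitz bound, convexity and weak continuity of the cost *)

Section cost_regularity.
Variable R : realType.
Implicit Types (x y w : I01 R) (p q : prob01 R).

Lemma mean_dist_lip y y' p : mean_dist y p - mean_dist y' p <= i01_dist y y'.
Proof.
pose P : probability (I01 R) R := p.
have dist_int z : P.-integrable setT (EFin \o i01_dist z).
  apply: (@integrable_probability _ _ _ P _ 1 (measurable_i01_dist z)) => w.
  by rewrite normr_id; exact: i01_dist_le1.
rewrite /mean_dist -RintegralB//.
rewrite -[leRHS](Rintegral_cst_probability P); apply: le_Rintegral => //.
- apply: (@integrable_probability _ _ _ P _ 1) => [|w].
    by apply: measurable_funB; exact: measurable_i01_dist.
  by rewrite (le_trans (i01_dist_lip _ _ _))// i01_dist_le1.
- apply: (@integrable_probability _ _ _ P _ 1) => // w.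
  by rewrite normr_id; exact: i01_dist_le1.
- by move=> w _; rewrite (le_trans (ler_norm _))// i01_dist_lip.
Qed.

(** On [0,1] the function w -> |y - w| is 1-Lipschitz and bounded by 1, so it competes in the
    supremum; its opposite gives the other sign. *)
Lemma mean_dist_KR y p p' :
  `|mean_dist y p - mean_dist y p'| <= KR_dist p p'.
Proof.
set S := [set f : I01 R -> R |
    (forall y z, `|f y - f z| <= `|i01_val y - i01_val z|) /\
    (forall y, `|f y| <= 1)].
have mS f : S f -> measurable_fun setT f.
  move=> [f_lip _]; apply: continuous_i01_measurable => z.
  apply/(@cvgrPdist_lt _ _ _ (nbhs z) (nbhs_filter z)) => e e0.
  have := @continuous_i01_val R z.
  move=> /(@cvgrPdist_lt _ _ _ (nbhs z) (nbhs_filter z)) /(_ e e0).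
  by apply: filterS => w; exact: le_lt_trans (f_lip _ _).
have le_KR f : S f -> \int[p : probability (I01 R) R]_y f y -
    \int[p' : probability (I01 R) R]_y f y <= KR_dist p p'.
  move=> Sf; apply: ub_le_sup; last by exists f.
  (* [sup] dominates its elements only for a set bounded above; integrals of functions with values
     in [-1,1] differ by at most 2. *)
  exists 2 => _ [g Sg <-]; have [_ g1] := Sg.
  have := normr_Rintegral_le (p : probability (I01 R) R) (mS _ Sg) g1.
  have := normr_Rintegral_le (p' : probability (I01 R) R) (mS _ Sg) g1.
  by rewrite !ler_norml => /andP[? ?] /andP[? ?]; lra.
have S_dist : S (i01_dist y).
  split=> [z w|z]; last by rewrite normr_id; exact: i01_dist_le1.
  rewrite (le_trans (ler_dist_dist _ _))// distrC.
  by rewrite (_ : _ - _ - _ = i01_val z - i01_val w)//; lra.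
have SN : S (fun w => -1 * i01_dist y w).
  case: S_dist => [d1 d2]; split=> [z w|z]; last by rewrite mulN1r normrN.
  by rewrite !mulN1r -opprD normrN.
have := le_KR _ SN; rewrite !RintegralZl//; first last.
- exact: integrable_probability (mS _ S_dist) S_dist.2.
- exact: integrable_probability (mS _ S_dist) S_dist.2.
have := le_KR _ S_dist; rewrite -!/(mean_dist _ _) ler_norml => ? ?.
by apply/andP; split; lra.
Qed.

(** The variation in p is kept as a difference of [mean_dist] at the same y, to be bounded by
    [KR_dist] in one use and by weak continuity in the other. The factor 3 is 2 from [graph_gap]
    plus 1 from [mean_dist]. *)
Lemma cost_dist_le x x' y y' p p' :
  `|cost (x, y, p) - cost (x', y', p')| <=
  i01_dist x x' + 3 * i01_dist y y' + `|mean_dist y p - mean_dist y p'|.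
Proof.
rewrite /cost/=.
have := graph_gap_lip x x' y y'; have := graph_gap_lip x' x y' y.
have := mean_dist_lip y y' p'; have := mean_dist_lip y' y p'.
have := ler_norm (mean_dist y p - mean_dist y p').
have := lerNnormlW (lexx `|mean_dist y p - mean_dist y p'|).
rewrite /i01_dist (distrC (i01_val x')) (distrC (i01_val y')).
by move=> ? ? ? ? ? ?; rewrite ler_norml; apply/andP; split; lra.
Qed.

Lemma cost_lip x x' y y' p p' :
  `|cost (x, y, p) - cost (x', y', p')| <=
  3 * (`|i01_val x - i01_val x'| + `|i01_val y - i01_val y'| + KR_dist p p').
Proof.
have := cost_dist_le x x' y y' p p'; have := mean_dist_KR y p p'.
have := normr_ge0 (i01_val x - i01_val x').
by have := normr_ge0 (mean_dist y p - mean_dist y p'); rewrite /i01_dist; lra.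
Qed.

(** The integral is linear in the measure: the convex combination agrees with a sum of two scaled
    measures. Convexity of the cost thus holds with equality. *)
Lemma mean_dist_conv y (t : {i01 R}) p q :
  mean_dist y (prob01_conv t p q) =
  t%:num * mean_dist y p + (1 - t%:num) * mean_dist y q.
Proof.
pose P : probability (I01 R) R := p; pose Q : probability (I01 R) R := q.
have t0 : 0 <= t%:num :> R by [].
have t1 : 0 <= 1 - t%:num :> R by rewrite subr_ge0 le1.
pose m := measure_add (mscale (NngNum t0) P) (mscale (NngNum t1) Q).
have mf := measurable_i01_dist y.
have mfE : measurable_fun setT (EFin \o i01_dist y) by exact/measurable_EFinP.
have f0 w : (0 <= (i01_dist y w)%:E)%E by rewrite lee_fin normr_ge0.
have fin (S : probability (I01 R) R) :
    (\int[S]_w (i01_dist y w)%:E)%E \is a fin_num.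
  apply: integrable_fin_num => //.
  apply: (@integrable_probability _ _ _ S _ 1) => // w.
  by rewrite normr_id; exact: i01_dist_le1.
rewrite /mean_dist /Rintegral.
have -> : (\int[prob01_conv t p q : probability (I01 R) R]_w (i01_dist y w)%:E
    = \int[m]_w (i01_dist y w)%:E)%E.
  apply: eq_measure_integral => A mA _; apply: esym.
  exact: (measure_addE (mscale (NngNum t0) P) (mscale (NngNum t1) Q) A).
rewrite ge0_integral_measure_add// !ge0_integral_mscale// fineD ?fineM//.
- exact: fin.
- exact: fin.
- by rewrite fin_numM//; exact: fin.
- by rewrite fin_numM//; exact: fin.
Qed.

Lemma cost_convex x y (t : {i01 R}) p q :
  cost (x, y, prob01_conv t p q) <=
  t%:num * cost (x, y, p) + (1 - t%:num) * cost (x, y, q).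
Proof. by rewrite /cost/= mean_dist_conv; lra. Qed.

Lemma cost_ge0 (z : I01 R * I01 R * prob01 R) : 0 <= cost z.
Proof. by rewrite addr_ge0 ?graph_gap_ge0 ?mean_dist_ge0. Qed.

Lemma cost_le2 (z : I01 R * I01 R * prob01 R) : cost z <= 2.
Proof.
by rewrite /cost; have := graph_gap_le1 z.1.1 z.1.2;
  have := mean_dist_le1 z.1.2 z.2; lra.
Qed.

Lemma cost_bounded : bounded_fun (@cost R).
Proof.
exists 2; split; first exact: num_real.
move=> r r2 z _ /=; rewrite ger0_norm ?cost_ge0//.
by rewrite (le_trans (cost_le2 z))// ltW.
Qed.

(** The function w -> |y - w| is itself one of the test functions that generate the weak
    topology. *)
Lemma continuous_mean_dist y : continuous (mean_dist y).
Proof.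
have dist_cb : continuous (i01_dist y) /\ bounded_fun (i01_dist y).
  split; first exact: continuous_i01_dist.
  exists 1; split; first exact: num_real.
  move=> r r1 w _ /=; rewrite normr_id (le_trans (i01_dist_le1 y w))//.
  exact: ltW.
pose f : {f : I01 R -> R | continuous f /\ bounded_fun f} :=
  exist _ (i01_dist y) dist_cb.
move=> p; have : nbhs p --> p by [].
move=> /(@cvg_sup _ _ _ (nbhs p) p (nbhs_filter p)) /(_ f) pf.
have cf := @initial_continuous _ _ (fun p : prob01 R =>
  \int[p : probability (I01 R) R]_w i01_dist y w) p.
by move=> A /cf; exact: pf.
Qed.

Lemma continuous_cost : continuous (@cost R).
Proof.
move=> z; apply/(@cvgrPdist_lt _ _ _ (nbhs z) (nbhs_filter z)) => e e0.
(* [cost_dist_le] weighs the three deviations by 1, 3 and 1, which gives 5e/8 < e. Its last term is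
   taken at the y of the base point, so continuity of [mean_dist] at that single y is enough. *)
have e4 : 0 < e / 8 by rewrite divr_gt0.
have near_val (u : I01 R) : \forall v \near u, i01_dist u v < e / 8.
  have := @continuous_i01_val R u.
  by move=> /(@cvgrPdist_lt _ _ _ (nbhs u) (nbhs_filter u)) /(_ _ e4).
have near_mean : \forall q \near z.2,
    `|mean_dist z.1.2 z.2 - mean_dist z.1.2 q| < e / 8.
  have := @continuous_mean_dist z.1.2 z.2.
  by move=> /(@cvgrPdist_lt _ _ _ (nbhs z.2) (nbhs_filter z.2)) /(_ _ e4).
exists ([set u | i01_dist z.1.1 u.1 < e / 8 /\ i01_dist z.1.2 u.2 < e / 8],
  [set q | `|mean_dist z.1.2 z.2 - mean_dist z.1.2 q| < e / 8]).
  split=> //=.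
  exists ([set v | i01_dist z.1.1 v < e / 8],
    [set v | i01_dist z.1.2 v < e / 8]) => //=.
  by split; exact: near_val.
move=> [[x y] p] /= [[]]; case: z {near_val near_mean} => [[a b] q] /= xa yb pq.
by apply: (le_lt_trans (cost_dist_le _ _ _ _ _ _)); lra.
Qed.
End cost_regularity.

(** * Injective piecewise translations preserve Lebesgue measure *)

Section translation.
Variable R : realType.

(** The pushforward by a translation agrees with Lebesgue measure on half-open intervals, which
    determine it. *)
Lemma lebesgue_measure_translate (c : R) (A : set (measurableTypeR R)) :
  measurable A ->
  lebesgue_measure ((fun t : R => t + c) @^-1` A : set (measurableTypeR R)) =
  lebesgue_measure A.
Proof.
pose f : measurableTypeR R -> measurableTypeR R := fun t : R => t + c.
have mf : measurable_fun setT f by exact: measurable_funD.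
move=> mA; apply/esym.
pose m := pushforward (@lebesgue_measure R) f.
apply: (@lebesgue_measure_unique R m) => // _ [[a b]] _ <-.
rewrite /m /pushforward/=.
rewrite [X in _ = lebesgue_measure X](_ : _ =
    `]a - c, b - c]%classic); last first.
  by apply/seteqP; split=> t /=; rewrite /f !in_itv/= ltrBlDr lerBrDr.
rewrite !lebesgue_measure_itv/= !lte_fin ltrD2r.
by case: ifPn => // _; rewrite -!EFinB; congr EFin; lra.
Qed.

Lemma measurable_i01_preimage (A : set R) :
  measurable (A : set (measurableTypeR R)) -> measurable (@i01_val R @^-1` A).
Proof.
by move=> mA; rewrite -[X in measurable X]setTI; exact: measurable_i01_val.
Qed.

(** The hypothesis compares images in the line because a translation need not map [0,1] into
    itself. *)
Lemma lebesgue01_translate (c : R) (A B : set (I01 R)) : measurable A ->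
  (@i01_val R @` B = (fun t : R => t + c) @^-1` (@i01_val R @` A)) ->
  lebesgue01 B = lebesgue01 A.
Proof.
move=> mA BA; rewrite /lebesgue01 BA lebesgue_measure_translate//.
exact: measurable_i01_image.
Qed.

Section piecewise_translation.
Variables (T : I01 R -> I01 R) (i : I01 R -> nat) (c : nat -> R).
Hypothesis mi : forall k, measurable [set x | i x = k].
Hypothesis TE : forall x, i01_val (T x) = i01_val x + c (i x).
Hypothesis T_inj : injective T.

Lemma measurable_piecewise_translation : measurable_fun setT T.
Proof.
move=> _ B mB; rewrite setTI.
have -> : T @^-1` B = \bigcup_k ([set x | i x = k] `&`
    @i01_val R @^-1` ((fun t : R => t + c k) @^-1` (@i01_val R @` B))).
  apply/seteqP; split=> [x Bx|x [k _ [/= <- [y By yE]]]].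
    by exists (i x) => //; split=> //=; exists (T x); rewrite ?TE.
  by rewrite /= (_ : T x = y)//; apply: i01_val_inj; rewrite TE -yE.
apply: bigcupT_measurable => k; apply: measurableI => //.
apply: measurable_i01_preimage.
rewrite -[X in measurable X]setTI.
apply: (measurable_funD _ _ measurableT) => //.
exact: measurable_i01_image.
Qed.

Let piece (B : set (I01 R)) k := [set x | i x = k] `&` T @^-1` B.

Let image_pieceE B k :
  @i01_val R @` piece B k =
  (fun t : R => t + c k) @^-1` (@i01_val R @` (T @` piece B k)).
Proof.
apply/seteqP; split=> [_ [x Bx <-]|t [_ [x Bx <-] tE]].
  by exists (T x); [exists x|rewrite TE Bx.1].
exists x => //; move: tE; rewrite TE Bx.1; exact: addIr.
Qed.

Let measurable_piece B k : measurable B -> measurable (piece B k).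
Proof.
move=> mB; apply: measurableI => //.
by rewrite -[X in measurable X]setTI; exact: measurable_piecewise_translation.
Qed.

Let measurable_image_piece B k : measurable B -> measurable (T @` piece B k).
Proof.
move=> mB; have -> : T @` piece B k = @i01_val R @^-1`
    ((fun t : R => t + (- c k)) @^-1` (@i01_val R @` piece B k)).
  apply/seteqP; split=> [_ [x Bx <-]|y [x Bx xE]].
    by exists x => //; rewrite TE Bx.1 addrK.
  by exists x => //; apply: i01_val_inj; rewrite TE Bx.1 xE subrK.
apply: measurable_i01_preimage; rewrite -[X in measurable X]setTI.
apply: (measurable_funD _ _ measurableT) => //.
by apply: measurable_i01_image; exact: measurable_piece.
Qed.

(** The preimage of B splits into countably many pieces, each a translate of its image. The images
    are disjoint by injectivity and lie in B; without surjectivity at hand this yields only an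
    inequality. *)
Let le_piecewise_translation (B : set (I01 R)) : measurable B ->
  (lebesgue01 (T @^-1` B) <= lebesgue01 B)%E.
Proof.
move=> mB.
have -> : T @^-1` B = \bigcup_k piece B k.
  by apply/seteqP; split=> [x Bx|x [k _ []]//]; exists (i x).
rewrite measure_bigcup//=; last 2 first.
- by move=> k _; exact: measurable_piece.
- by move=> k l _ _ [x [[/= <- _] [/= <- _]]].
rewrite (eq_eseriesr (g := fun k => lebesgue01 (T @` piece B k))); last first.
  move=> k _; apply: (@lebesgue01_translate (c k)) => //.
  exact: measurable_image_piece.
rewrite -(measure_bigcup lebesgue01 setT (fun k => T @` piece B k)).
- apply: le_measure; rewrite ?inE//.
    by apply: bigcupT_measurable => k; exact: measurable_image_piece.
  by move=> _ [k _ [x [_ Bx] <-]].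
- by move=> k _; exact: measurable_image_piece.
- move=> k l _ _ [_ [[x [/= <- _] <-] [y [/= <- _]]]].
  by move=> /T_inj ->.
Qed.

Lemma piecewise_translation_measure_preserving (B : set (I01 R)) :
  measurable B -> lebesgue01 (T @^-1` B) = lebesgue01 B.
Proof.
move=> mB; have mTB : measurable (T @^-1` B).
  by rewrite -[X in measurable X]setTI; exact: measurable_piecewise_translation.
apply/eqP; rewrite eq_le le_piecewise_translation//=.
(* The total mass is 1, so the same inequality for the complement is the reverse inequality for
   B. *)
have := le_piecewise_translation (measurableC mB).
have := probability_setC lebesgue01 mTB; have := probability_setC lebesgue01 mB.
rewrite preimage_setC /= => -> ->.
rewrite -[lebesgue01 B]fineK ?fin_num_measure//.
rewrite -[lebesgue01 (T @^-1` B)]fineK ?fin_num_measure//.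
by rewrite -!EFinB !lee_fin lerD2l lerN2.
Qed.

End piecewise_translation.
End translation.

(** * The exchange of even and odd blocks *)

Section interval_exchange.
Variables (R : realType) (n : nat).
Local Notation N := n.+1.
Local Notation M := ((2 * N)%:R : R).
Implicit Types x y : I01 R.

Definition block x : nat := Num.truncn (i01_val x * M).

(* Even blocks go in order to the left half of [0,1], odd blocks to the right
   half; the index 2N stands for the point 1, which is fixed. *)
Definition block_perm (k : nat) : nat :=
  if (k < 2 * N)%N then (k./2 + odd k * N)%N else k.

Definition block_shift (k : nat) : R := ((block_perm k)%:R - k%:R) / M.

Lemma block_perm_inj : injective block_perm.
Proof. by move=> k l; rewrite /block_perm; case: ifP; case: ifP; lia. Qed.

Lemma block_perm_lt k : (block_perm k < 2 * N)%N = (k < 2 * N)%N.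
Proof. by rewrite /block_perm; case: ifPn => // k2N; lia. Qed.

Let M0 : 0 < M. Proof. by rewrite ltr0n. Qed.

Let blockP x : (block x)%:R <= i01_val x * M < (block x).+1%:R.
Proof. by apply: truncn_itv; rewrite mulr_ge0 ?i01_val_ge0. Qed.

Lemma block_max x : ~~ (block x < 2 * N)%N -> i01_val x = 1.
Proof.
rewrite -leqNgt -(ler_nat R) => b2N; have /andP[b_le _] := blockP x.
apply/eqP; rewrite eq_le i01_val_le1/= -(ler_pM2r M0) mul1r.
exact: le_trans b2N b_le.
Qed.

(** In units of the block length, the offset inside the block is kept and only the block index
    changes. *)
Let shiftM x :
  (i01_val x + block_shift (block x)) * M =
  i01_val x * M - (block x)%:R + (block_perm (block x))%:R.
Proof. by rewrite mulrDl divfK ?lt0r_neq0//; lra. Qed.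

Lemma exchange_subproof x :
  (i01_val x + block_shift (block x)) \in `[0%R : R, 1%R]%classic.
Proof.
rewrite inE/= in_itv/= -(ler_pM2r M0) mul0r -(ler_pM2r M0 _ 1) mul1r shiftM.
have /andP[b1 b2] := blockP x.
have p0 : 0 <= (block_perm (block x))%:R :> R by [].
apply/andP; split; first by lra.
have [bN|bN] := boolP (block x < 2 * N)%N.
  move: b2; rewrite -natr1 => b2.
  (* The target block also has index below 2N, so its right end is at most 1. *)
  have : (block_perm (block x)).+1%:R <= M by rewrite ler_nat block_perm_lt.
  by rewrite -natr1; lra.
rewrite /block_perm (negbTE bN) addrNK.
by rewrite ler_piMl ?i01_val_le1// ltW.
Qed.

Definition exchange x : I01 R :=
  exist (fun r : R => r \in `[0%R, 1%R]%classic) _ (exchange_subproof x).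

Lemma exchangeE x : i01_val (exchange x) = i01_val x + block_shift (block x).
Proof. by []. Qed.

Lemma block_exchange x : block (exchange x) = block_perm (block x).
Proof.
apply: truncn_def; rewrite exchangeE shiftM -natr1.
have /andP[b1] := blockP x; rewrite -natr1 => b2.
by apply/andP; split; lra.
Qed.

Lemma exchange_inj : injective exchange.
Proof.
move=> x y xy; have bxy : block x = block y.
  by apply: block_perm_inj; rewrite -!block_exchange xy.
apply: i01_val_inj; have := congr1 (@i01_val R) xy.
by rewrite !exchangeE bxy => /addIr.
Qed.

Lemma measurable_block k : measurable [set x | block x = k].
Proof.
have -> : [set x | block x = k] =
    @i01_val R @^-1` `[k%:R / M, k.+1%:R / M[%classic.
  apply/seteqP; split=> x /=; rewrite in_itv/= ler_pdivrMr// ltr_pdivlMr//.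
    by move=> <-; exact: blockP.
  exact: truncn_def.
exact: measurable_i01_preimage.
Qed.

Lemma measurable_exchange : measurable_fun setT exchange.
Proof.
exact: (measurable_piecewise_translation measurable_block exchangeE).
Qed.

Lemma exchange_measure_preserving (B : set (I01 R)) : measurable B ->
  lebesgue01 (exchange @^-1` B) = lebesgue01 B.
Proof.
exact: (piecewise_translation_measure_preserving measurable_block exchangeE
  exchange_inj).
Qed.

(** If x lies in block k < 2N, then 2y - x for the image y of x differs from the parity of k by
    (offset - parity)/M, where the offset is in [0,1). The remaining point 1 is fixed and has gap
    0. *)
Lemma graph_gap_exchange x : graph_gap x (exchange x) <= M^-1.
Proof.
(* The distance to {0, 1} is at most the distance to either point. *)
have gap_le (u b : R) : b = 0 \/ b = 1 -> `| `|u - 1/2| - 1/2| <= `|u - b|.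
  move=> b01; have := normr_ge0 (u - b).
  have := ler_norm (u - b); have := lerNnormlW (lexx `|u - b|).
  rewrite ler_norml => h1 h2 h3; have [uh|uh] := leP 0 (u - 1 / 2).
    rewrite (ger0_norm uh); case: b01 => bE; rewrite bE in h1 h2 h3 *;
    by apply/andP; split; lra.
  rewrite (ltr0_norm uh); case: b01 => bE; rewrite bE in h1 h2 h3 *;
  by apply/andP; split; lra.
have Mi0 : 0 < M^-1 by rewrite invr_gt0.
rewrite /graph_gap; have [bN|bN] := boolP (block x < 2 * N)%N; last first.
  apply: (le_trans (gap_le _ 1 _)); first by right.
  rewrite exchangeE /block_shift /block_perm (negbTE bN) subrr mul0r addr0.
  by rewrite (block_max bN) (_ : _ - 1 = 0) ?normr0 ?ltW//; lra.
apply: (le_trans (gap_le _ (odd (block x))%:R _)).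
  by case: odd; [right|left].
set r : R := (block x)%:R.
rewrite (_ : _ - _ = (i01_val x * M - r - (odd (block x))%:R) / M).
  rewrite normrM (gtr0_norm Mi0) ler_piMl ?(ltW Mi0)//.
  have /andP[b1] := blockP x; rewrite -natr1 -/r => b2.
  by rewrite ler_norml; case: odd => /=; apply/andP; split; lra.
(* As k is twice its half plus its parity, doubling the new index restores k minus its parity; odd
   blocks gain 2N = M. *)
have pE : 2 * (block_perm (block x))%:R = r - (odd (block x))%:R +
    (odd (block x))%:R * M :> R.
  apply/eqP; rewrite -subr_eq0; apply/eqP.
  rewrite /block_perm bN /r -{3}(odd_double_half (block x)).
  by rewrite -muln2 !natrD !natrM; ring.
apply: (mulIf (lt0r_neq0 M0)); rewrite divfK ?lt0r_neq0//.
rewrite !mulrBl -mulrA exchangeE shiftM -/r; move: pE; lra.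
Qed.

End interval_exchange.

(** * Plans carried by the graph of a measure-preserving map *)

Lemma Rintegral_dirac d (T : measurableType d) (R : realType) (a : T)
  (f : T -> R) : measurable_fun setT f -> \int[\d_a]_y f y = f a.
Proof.
move=> mf; rewrite /Rintegral integral_dirac//; last exact/measurable_EFinP.
by rewrite diracT mul1e.
Qed.

Lemma measurable_graph_gap (R : realType) :
  measurable_fun setT (fun z : I01 R * I01 R => graph_gap z.1 z.2).
Proof.
have m1 : measurable_fun setT (fun z : I01 R * I01 R => i01_val z.1).
  exact: measurableT_comp (@measurable_i01_val R) measurable_fst.
have m2 : measurable_fun setT (fun z : I01 R * I01 R => i01_val z.2).
  exact: measurableT_comp (@measurable_i01_val R) measurable_snd.
apply: measurableT_comp => //; apply: measurable_funB => //.
apply: measurableT_comp => //; apply: measurable_funB => //.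
by apply: measurable_funB => //; apply: measurable_funM.
Qed.

Lemma measurable_i01_dist2 (R : realType) (f g : I01 R * I01 R -> I01 R) :
  measurable_fun setT f -> measurable_fun setT g ->
  measurable_fun setT (fun z => i01_dist (f z) (g z)).
Proof.
move=> mf mg; apply: measurableT_comp => //; apply: measurable_funB.
  exact: measurableT_comp (@measurable_i01_val R) mf.
exact: measurableT_comp (@measurable_i01_val R) mg.
Qed.

Section graph_plan.
Variables (R : realType) (T : I01 R -> I01 R).
Hypothesis mT : measurable_fun setT T.
Hypothesis T_preserving : forall B : set (I01 R), measurable B ->
  lebesgue01 (T @^-1` B) = lebesgue01 B.

Lemma measurable_graph : measurable_fun setT (fun x => (x, T x)).
Proof. exact: measurable_fun_pair. Qed.

Definition graph_plan : probability (I01 R * I01 R)%type R :=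
  distribution lebesgue01 (mfun_Sub (mem_set measurable_graph)).

Definition graph_conditional (x : I01 R) : probability (I01 R) R := \d_(T x).

Lemma Rintegral_graph_plan (f : I01 R * I01 R -> R) (M : R) :
  measurable_fun setT f -> (forall z, `|f z| <= M) ->
  \int[graph_plan]_z f z = \int[lebesgue01]_x f (x, T x).
Proof.
move=> mf fM; rewrite /Rintegral /graph_plan integral_distribution//.
  exact/measurable_EFinP.
apply: (@integrable_probability _ _ _ _ _ M) => //.
exact: measurableT_comp mf measurable_graph.
Qed.

Lemma graph_plan_transport : transport_plan lebesgue01 lebesgue01 graph_plan.
Proof. by split=> // B mB; exact: T_preserving. Qed.

Lemma graph_plan_conditional :
  conditional_measures lebesgue01 graph_plan graph_conditional.
Proof.
split=> [B mB C mC|phi psi mphi [M1 [_ bphi]] mpsi [M2 [_ bpsi]]].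
  (* The mass of B is the indicator of its preimage under T, hence measurable outright, and the null
     part is empty. *)
  exists ((fun x => graph_conditional x B) @^-1` C); last first.
    by exists set0; [exact: negligible_set0|rewrite setU0].
  rewrite -[X in measurable X]setTI.
  have : measurable_fun setT (fun x => graph_conditional x B); last exact.
  rewrite /graph_conditional/= /dirac.
  apply/measurable_EFinP.
  exact: measurableT_comp mT.
(* [bounded_fun] gives bounds only by constants strictly above M1 and M2, hence the + 1. *)
rewrite (@Rintegral_graph_plan _ ((M1 + 1) * (M2 + 1))).
- apply: eq_Rintegral => x _; rewrite Rintegral_dirac//.
  exact: measurable_funM.
- apply: measurable_funM.
    exact: measurableT_comp mphi measurable_fst.
  exact: measurableT_comp mpsi measurable_snd.
- move=> z; rewrite normrM ler_pM//.
    by apply: (bphi (M1 + 1)) => //; rewrite ltrDl.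
  by apply: (bpsi (M2 + 1)) => //; rewrite ltrDl.
Qed.

(** With Dirac conditionals the second term is |y - T x|, which vanishes on the graph. *)
Lemma graph_plan_cost (e : R) : (forall x, graph_gap x (T x) <= e) ->
  kantorovich_cost (@cost R) graph_plan graph_conditional <= e.
Proof.
move=> gap_e; rewrite /kantorovich_cost.
have costE z : cost (z, graph_conditional z.1) =
    graph_gap z.1 z.2 + i01_dist z.2 (T z.1).
  by rewrite /cost/= /mean_dist Rintegral_dirac//; exact: measurable_i01_dist.
rewrite (_ : (fun z => _) = fun z => graph_gap z.1 z.2 + i01_dist z.2 (T z.1));
  last exact/funext.
rewrite (@Rintegral_graph_plan _ 2); last 2 first.
- apply: measurable_funD; first exact: measurable_graph_gap.
  apply: measurable_i01_dist2; first exact: measurable_snd.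
  exact: measurableT_comp mT measurable_fst.
- by move=> z; rewrite -costE ger0_norm ?cost_ge0// cost_le2.
rewrite -[leRHS](Rintegral_cst_probability (@lebesgue01 R)).
apply: (@le_Rintegral_nonmeasurable _ _ _ _ _ _ e) => // x /=.
  by apply: addr_ge0; exact: normr_ge0.
by rewrite /i01_dist subrr normr0 addr0.
Qed.

End graph_plan.

(** * Plans carried by the two lines have positive cost *)

Section graph_supported_plan.
Variables (R : realType) (sigma : probability (I01 R * I01 R)%type R).
Variable s : I01 R -> probability (I01 R) R.
Hypothesis sigma_plan : transport_plan lebesgue01 lebesgue01 sigma.
Hypothesis sigma_cond : conditional_measures lebesgue01 sigma s.
Hypothesis gap0 : \int[sigma]_z graph_gap z.1 z.2 <= 0.

Let left_half : set (I01 R) := @i01_val R @^-1` `]0, 1/2[%classic.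

Let m_left_half : measurable left_half.
Proof. exact: measurable_i01_preimage. Qed.

Lemma graph_gap_null : exists Z : set (I01 R * I01 R),
  [/\ measurable Z, sigma Z = 0%E &
      forall z, ~ Z z -> graph_gap z.1 z.2 = 0].
Proof.
have mgap := @measurable_graph_gap R.
have igap : sigma.-integrable setT
    (fun z => (graph_gap z.1 z.2)%:E).
  apply: (@integrable_probability _ _ _ _ _ 1) => // z.
  by rewrite ger0_norm ?graph_gap_ge0// graph_gap_le1.
have int0 : (\int[sigma]_z `|(graph_gap z.1 z.2)%:E| = 0)%E.
  under eq_integral do rewrite gee0_abs ?lee_fin ?graph_gap_ge0//.
  rewrite -[LHS]fineK; last exact: integrable_fin_num.
  congr EFin; apply/eqP; rewrite eq_le [X in X && _]gap0/=.
  by apply: Rintegral_ge0 => z _; exact: graph_gap_ge0.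
have mgapE : measurable_fun setT
    (fun z : I01 R * I01 R => (graph_gap z.1 z.2)%:E).
  exact/measurable_EFinP.
have /(ae_eq_integral_abs sigma measurableT mgapE)[Z [mZ Z0 subZ]] := int0.
exists Z; split => // z Zz; apply: contrapT => gap_neq0.
by apply: Zz; apply: subZ => /= /(_ I) [].
Qed.

(** Almost surely, x in C and y in the left half force y = x/2 in P, so the plan gives this event at
    most |P|. Conversely y in P or Q forces x in C, so |P| + |Q| is at most |C|, and |Q| = |P| by
    translation. *)
Lemma le_left_half_plan (C : set (I01 R)) : measurable C ->
  2 * fine (sigma (fst @^-1` C `&` snd @^-1` left_half)) <=
  fine (lebesgue01 C).
Proof.
move=> mC.
(* P and Q below are the images of C under x -> x/2 and x -> (x+1)/2, cut to the open halves. *)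
pose C' : set R := @i01_val R @` C.
pose P : set (I01 R) := @i01_val R @^-1`
  (`]0, 1/2[%classic `&` [set t | C' (2 * t)]).
pose Q : set (I01 R) := @i01_val R @^-1`
  (`]1/2, 1[%classic `&` [set t | C' (2 * t - 1)]).
have mC' : measurable (C' : set (measurableTypeR R)).
  exact: measurable_i01_image.
have mP : measurable P.
  apply: measurable_i01_preimage; apply: measurableI => //.
  rewrite -[X in measurable X]setTI.
  have : measurable_fun setT (fun t : measurableTypeR R => 2 * t : R).
    exact: measurable_funM.
  exact.
have mQ : measurable Q.
  apply: measurable_i01_preimage; apply: measurableI => //.
  rewrite -[X in measurable X]setTI.
  have : measurable_fun setT (fun t : measurableTypeR R => 2 * t - 1 : R).
    by apply: measurable_funB => //; exact: measurable_funM.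
  exact.
have gap_cases (z : I01 R * I01 R) : graph_gap z.1 z.2 = 0 ->
    i01_val z.1 = 2 * i01_val z.2 \/ i01_val z.1 = 2 * i01_val z.2 - 1.
  move=> /normr0_eq0 /subr0_eq.
  have [u0|u0] := leP 0 (2 * i01_val z.2 - i01_val z.1 - 1 / 2).
    by rewrite ger0_norm// => uE; right; lra.
  by rewrite ltr0_norm// => uE; left; lra.
have m1 A : measurable A -> measurable (fst @^-1` A : set (I01 R * I01 R)).
  by move=> mA; rewrite -[X in measurable X]setTI; exact: measurable_fst.
have m2 A : measurable A -> measurable (snd @^-1` A : set (I01 R * I01 R)).
  by move=> mA; rewrite -[X in measurable X]setTI; exact: measurable_snd.
have [Z [mZ Z0 gapZ]] := graph_gap_null.
have {Z0} le_null (A B : set (I01 R * I01 R)) : measurable A -> measurable B ->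
    A `<=` B `|` Z -> (sigma A <= sigma B)%E.
  move=> mA mB AB; rewrite -[leRHS]adde0 -Z0.
  apply: (le_trans _ (measureU2 _ _ _)) => //.
  by apply: le_measure; rewrite ?inE//; exact: measurableU.
have le_P : (sigma (fst @^-1` C `&` snd @^-1` left_half) <= lebesgue01 P)%E.
  rewrite -sigma_plan.2//; apply: le_null.
  - by apply: measurableI; [exact: m1|exact: m2].
  - exact: m2.
  - move=> z [/= Cz Hz]; have [Zz|nZz] := pselect (Z z); first by right.
    left; split=> //=; have zx := i01_val_ge0 z.1.
    move: Hz; rewrite /left_half/= in_itv/= => /andP[h1 h2].
    (* For y < 1/2 the other line would give a negative x. *)
    have [zE|zE] := gap_cases z (gapZ z nZz); last by lra.
    by exists z.1.
have le_C : (lebesgue01 (P `|` Q) <= lebesgue01 C)%E.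
  rewrite -sigma_plan.2; last exact: measurableU.
  rewrite -sigma_plan.1//; apply: le_null.
  - by apply: m2; exact: measurableU.
  - exact: m1.
  - move=> z PQz; have [Zz|nZz] := pselect (Z z); first by right.
    left; have := gap_cases z (gapZ z nZz).
    have := i01_val_ge0 z.1; have := i01_val_le1 z.1.
    case: PQz => -[/=]; rewrite in_itv/= => /andP[h1 h2] [x Cx xE] x0 x1 h.
      by rewrite (_ : z.1 = x)//; apply: i01_val_inj; rewrite xE; lra.
    by rewrite (_ : z.1 = x)//; apply: i01_val_inj; rewrite xE; lra.
have PQ0 : P `&` Q = set0.
  rewrite -subset0 => y [[/=]]; rewrite in_itv/= => /andP[_ y1] _ [/=].
  by rewrite in_itv/= => /andP[y2 _] _; have := lt_trans y1 y2; rewrite ltxx.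
have QP : lebesgue01 Q = lebesgue01 P.
  apply: (@lebesgue01_translate _ (- (1 / 2))) => //.
  rewrite /P /Q !i01_val_image_preimage.
  apply/seteqP; split=> t /=; rewrite !in_itv/= => -[[/andP[t1 t2] Ct]] _.
    split; last by apply/andP; split; lra.
    split; first by apply/andP; split; lra.
    by rewrite (_ : 2 * _ = 2 * t - 1)//; lra.
  split; last by apply/andP; split; lra.
  split; first by apply/andP; split; lra.
  by rewrite (_ : 2 * t - 1 = 2 * (t - 1 / 2))//; lra.
have PUQ : lebesgue01 (P `|` Q) = (lebesgue01 P + lebesgue01 P)%E.
  by rewrite -{2}QP; exact: measureU.
move: le_C; rewrite {}PUQ {QP}.
have fine_mono (a b : \bar R) : a \is a fin_num -> b \is a fin_num ->
  (a <= b)%E -> fine a <= fine b by exact: fine_le.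
have fl A : measurable A -> lebesgue01 A \is a fin_num.
  by move=> mA; exact: fin_num_measure.
move=> /fine_mono; rewrite fin_numD !fl// fineD ?fl// => /(_ isT isT) le_C.
have := fine_mono _ _ _ _ le_P; rewrite fl// fin_num_measure//; last first.
  by apply: measurableI; [exact: m1|exact: m2].
by move=> /(_ isT isT); lra.
Qed.

(** On the set M where the mass exceeds 3/4, the plan gives M times the left half at least 3/4 |M|,
    but at most |M|/2 by [le_left_half_plan]; so M is null. Any constant strictly between 1/2 and 1
    would serve as well as 3/4. *)
Lemma ae_left_half_le : exists D : set (I01 R),
  [/\ measurable D, lebesgue01 (~` D) = 0%E &
      forall x, D x -> fine (s x left_half) <= 3 / 4].
Proof.
have [ms disint] := sigma_cond.
(* The superlevel set is measurable only for the completion: it is M together with N, a part of the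
   measurable null set N'. *)
have [M mM [N [N' [mN' N'0 NN'] MNE]]] :=
  ms _ m_left_half `](3 / 4 : R)%:E, +oo%E]%classic (emeasurable_itv _).
have M_gt x : M x -> 3 / 4 < fine (s x left_half).
  move=> Mx; have : (M `|` N) x by left.
  rewrite MNE/= in_itv/= leey andbT.
  by rewrite -[X in (_ < X)%E -> _]fineK ?lte_fin// fin_num_measure.
have mf : measurable (fst @^-1` M `&` snd @^-1` left_half
    : set (I01 R * I01 R)).
  by apply: measurableI; rewrite -[X in measurable X]setTI;
    [exact: measurable_fst|exact: measurable_snd].
have indic_bounded d (U : measurableType d) (A : set U) :
    bounded_fun (\1_A : U -> R).
  exists 1; split; first exact: num_real.
  move=> r r1 x _ /=; rewrite indicE (le_trans _ (ltW r1))//.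
  by case: (_ \in _); rewrite ?normr1 ?normr0.
(* Indicators as test functions express the plan's mass of M times the left half as the integral
   over M of the conditional masses. *)
have := disint (\1_M) (\1_left_half) (measurable_indic mM) (indic_bounded _ _ M)
  (measurable_indic m_left_half) (indic_bounded _ _ left_half).
under eq_Rintegral => z _.
  rewrite (_ : _ * _ =
    1 * \1_(fst @^-1` M `&` snd @^-1` left_half) z); last first.
    by rewrite mul1r indicI.
  over.
rewrite Rintegral_indic// mul1r.
under [RHS]eq_Rintegral do rewrite Rintegral_indic//.
move=> sigmaM.
have le_int : 3 / 4 * fine (lebesgue01 M) <=
    fine (sigma (fst @^-1` M `&` snd @^-1` left_half)).
  rewrite sigmaM -Rintegral_indic//.
  apply: (@le_Rintegral_nonmeasurable _ _ _ _ _ _ 1) => x.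
  - by rewrite mulr_ge0// indicE.
  - rewrite indicE; case: (boolP (x \in M)) => [/set_mem/M_gt/ltW|_].
      by rewrite mulr1 mul1r.
    by rewrite mulr0 mul0r.
  - rewrite indicE; case: (_ \in _); rewrite ?mul0r// mul1r.
    rewrite -lee_fin fineK ?fin_num_measure//; exact: probability_le1.
have M0 : lebesgue01 M = 0%E.
  have := le_left_half_plan mM; have : 0 <= fine (lebesgue01 M).
    exact: fine_ge0.
  move=> M_ge0 M_le; have fM0 : fine (lebesgue01 M) = 0 by lra.
  by rewrite -[LHS]fineK ?fM0// fin_num_measure.
exists (~` (M `|` N')); rewrite setCK; split.
- by apply: measurableC; exact: measurableU.
- apply/eqP; rewrite eq_le measure_ge0 andbT.
  by rewrite -[leRHS]adde0 -{1}M0 -N'0; exact: measureU2.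
- move=> x Dx; rewrite leNgt; apply/negP => sx.
  have : (M `|` N) x.
    rewrite MNE/= in_itv/= leey andbT -[X in (_ < X)%E]fineK ?lte_fin//.
    exact: fin_num_measure.
  by move=> [Mx|/NN' Nx]; apply: Dx; [left|right].
Qed.

(** For x in D the conditional measure gives at least 1/4 to the complement of (0,1/2), and points y
    of [1/8,1/4] are at distance at least 1/8 from it. The cost is thus at least 1/32 on W, which
    has positive mass. *)
Lemma kantorovich_cost_gt0 : 0 < kantorovich_cost (@cost R) sigma s.
Proof.
have [D [mD D0 sD]] := ae_left_half_le.
pose V : set (I01 R) := @i01_val R @^-1` `[1 / 8, 1 / 4]%classic.
have mV : measurable V by exact: measurable_i01_preimage.
have V8 : lebesgue01 V = (1 / 8)%:E.
  rewrite /lebesgue01 i01_val_image_preimage.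
  rewrite (_ : _ `&` _ = `[1 / 8, 1 / 4]%classic).
    by rewrite lebesgue_measure_itv/= lte_fin ifT -?EFinB; [congr EFin|]; lra.
  apply/seteqP; split=> t /=; rewrite !in_itv/=; first by case.
  by move=> /andP[t1 t2]; split; apply/andP; split=> //; lra.
pose W : set (I01 R * I01 R) := fst @^-1` D `&` snd @^-1` V.
have m1 A : measurable A -> measurable (fst @^-1` A : set (I01 R * I01 R)).
  by move=> mA; rewrite -[X in measurable X]setTI; exact: measurable_fst.
have m2 A : measurable A -> measurable (snd @^-1` A : set (I01 R * I01 R)).
  by move=> mA; rewrite -[X in measurable X]setTI; exact: measurable_snd.
have mW : measurable W by apply: measurableI; [exact: m1|exact: m2].
(* The second marginal gives the strip over V mass 1/8, and the first marginal makes the part with x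
   outside D null. *)
have W8 : ((1 / 8)%:E <= sigma W)%E.
  rewrite -V8 -sigma_plan.2// -[leRHS]adde0 -D0 -sigma_plan.1; last first.
    exact: measurableC.
  apply: (le_trans _ (measureU2 _ _ _)) => //.
    apply: le_measure; rewrite ?inE; [exact: m2| |].
      by apply: measurableU => //; apply: m1; exact: measurableC.
    move=> z Vz; have [Dz|nDz] := pselect (D z.1); [by left|by right].
  by apply: m1; exact: measurableC.
have W0 : 0 < fine (sigma W).
  rewrite fine_gt0//; apply/andP; split.
    by apply: lt_le_trans W8; rewrite lte_fin; lra.
  by rewrite ltey_eq fin_num_measure.
suff : 1 / 32 * fine (sigma W) <= kantorovich_cost (@cost R) sigma s.
  by apply: lt_le_trans; rewrite mulr_gt0//; lra.
rewrite -Rintegral_indic//.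
apply: (@le_Rintegral_nonmeasurable _ _ _ _ _ _ 2) => z.
- by rewrite mulr_ge0// indicE.
- rewrite indicE; case: (boolP (z \in W)) => [/set_mem[Dz Vz]|_]; last first.
    by rewrite mulr0 cost_ge0.
  rewrite mulr1 /cost/=.
  apply: (@le_trans _ _ (mean_dist z.2 (s z.1))); last first.
    by rewrite lerDr graph_gap_ge0.
  have far_half : 1 / 4 <= fine (s z.1 (~` left_half)).
    have /(congr1 fine) := probability_setC (s z.1) m_left_half.
    rewrite -[s z.1 left_half]fineK ?fin_num_measure//= => ->.
    by have := sD _ Dz; lra.
  apply: (@le_trans _ _ (1 / 8 * fine (s z.1 (~` left_half)))); first by lra.
  rewrite -Rintegral_indic; last exact: measurableC.
  apply: (@le_Rintegral_nonmeasurable _ _ _ _ _ _ 1) => y.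
  + by rewrite mulr_ge0// indicE.
  + rewrite indicE; case: (boolP (y \in _)) => [/set_mem/= Hy|_]; last first.
      by rewrite mulr0 normr_ge0.
    move: Vz; rewrite /V/= in_itv/= mulr1 /i01_dist => /andP[v1 v2].
    rewrite leNgt; apply/negP => zy; apply: Hy.
    move: zy; rewrite ltr_norml => /andP[zy1 zy2].
    by rewrite /left_half/= in_itv/=; apply/andP; split; lra.
  + exact: i01_dist_le1.
- exact: cost_le2.
Qed.

End graph_supported_plan.

(** * The infimum 0 is not attained *)

Theorem theorem2p2 (R : realType) :
  exists h : I01 R * I01 R * prob01 R -> R,
    [/\ bounded_fun h,
        continuous h,
        (exists L : R, forall (x x' y y' : I01 R) (p p' : prob01 R),
          `|h (x, y, p) - h (x', y', p')| <=
          L * (`|i01_val x - i01_val x'| + `|i01_val y - i01_val y'|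
               + KR_dist p p')),
        (forall (x y : I01 R) (t : {i01 R}) (p q : prob01 R),
          h (x, y, prob01_conv t p q) <=
          t%:num * h (x, y, p) + (1 - t%:num) * h (x, y, q)) &
        ~ exists sigma : probability (I01 R * I01 R)%type R,
            kantorovich_minimizer h lebesgue01 lebesgue01 sigma].
Proof.
exists (@cost R); split.
- exact: cost_bounded.
- exact: continuous_cost.
- by exists 3; exact: cost_lip.
- exact: cost_convex.
move=> [sigma [sigma_plan [s sigma_cond sigma_min]]].
have cost_le0 : kantorovich_cost (@cost R) sigma s <= 0.
  apply/ler_addgt0Pl => e e0; rewrite addr0.
  (* With n + 1 > 1/e, the exchange of 2(n + 1) blocks has gap at most 1/(2(n + 1)) <= e, hence a
     plan of cost at most e. *)
  have [n ne] : exists n : nat, e^-1 < n.+1%:R.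
    by exists (Num.truncn e^-1); exact: truncnS_gt.
  have := sigma_min _ _
    (graph_plan_transport (measurable_exchange n)
      (@exchange_measure_preserving R n))
    (graph_plan_conditional (measurable_exchange n)).
  move=> /le_trans; apply; apply: graph_plan_cost.
  move=> x; apply: (le_trans (graph_gap_exchange n x)).
  rewrite invf_ple ?posrE//; apply: (le_trans (ltW ne)).
  by rewrite ler_nat leq_pmull.
(* Both terms of the cost are nonnegative, so a minimizer is carried by the two lines, where the
   cost was shown to be positive. *)
have gap_le0 : \int[sigma]_z graph_gap z.1 z.2 <= 0.
  apply: le_trans cost_le0.
  apply: (@le_Rintegral_nonmeasurable _ _ _ _ _ _ 2) => z.
  - exact: graph_gap_ge0.
  - by rewrite lerDl mean_dist_ge0.
  - exact: cost_le2.
have := kantorovich_cost_gt0 sigma_plan sigma_cond gap_le0.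
by rewrite ltNge cost_le0.
Qed.
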